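(* Suppose $(G,g)$ is a pseudo-Riemannian Lie group that can be Wick-rotated to another pseudo-Riemannian Lie group $(\tilde G,\tilde g)$. Let $\mathfrak g,\tilde{\mathfrak g}$ be their Lie algebras. Then there exists a Cartan involution of $\mathfrak g$ (with respect to $g$) if and only if there exists a Cartan involution of $\tilde{\mathfrak g}$ (with respect to $\tilde g$).
   Context: A pseudo-Riemannian Lie group $(G,g)$ is a real Lie group $G$ with a left-invariant pseudo-Riemannian metric, identified with a symmetric non-degenerate bilinear form $g$ on the Lie algebra $\mathfrak g$. A holomorphic Riemannian Lie group $(G^{\mathbb C},g^{\mathbb C})$ is a complex Lie group with a left-invariant holomorphic metric, i.e. a symmetric non-degenerate complex bilinear form $g^{\mathbb C}$ on its complex Lie algebra $\mathfrak g^{\mathbb C}$. An immersive real form of $G^{\mathbb C}$ is a real Lie group $G$ with an immersive homomorphism of real Lie groups $G\to G^{\mathbb C}$ whose differential embeds $\mathfrak g$ as a real form of $\mathfrak g^{\mathbb C}$. A real slice of Lie groups $(G,g)\subset(G^{\mathbb C},g^{\mathbb C})$ is an immersive real form such that $g^{\mathbb C}$ is real valued and non-degenerate on $\mathfrak g$, equipped with the left-invariant metric $g:=g^{\mathbb C}|_{\mathfrak g}$. $(G,g)$ is (can be) Wick-rotated to $(\tilde G,\tilde g)$ if both are real slices of Lie groups of a common holomorphic Riemannian Lie group $(G^{\mathbb C},g^{\mathbb C})$. A Cartan involution of $\mathfrak g$ (with respect to $g$) is a Lie algebra homomorphism $\theta:\mathfrak g\to\mathfrak g$ with $\theta^2=1$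 (the identity is allowed), which is an isometry of $g$, and such that $g_\theta(x,y):=g(x,\theta(y))$ is positive definite on $\mathfrak g$. *)

(* Defs.v *)
From HB Require Import structures.
From mathcomp Require Import all_boot all_order all_algebra sesquilinear complex.
From mathcomp Require Import all_classical all_reals all_analysis.
Set Implicit Arguments.
Unset Strict Implicit.
Unset Printing Implicit Defensive.
Import Order.TTheory GRing.Theory Num.Theory numFieldNormedType.Exports.
Local Open Scope classical_set_scope.
Local Open Scope ring_scope.
Local Open Scope complex_scope.

(** * Smooth maps between normed spaces *)

(* The spaces are finite dimensional in every use below, where this is the
   usual class C^k over K.  For K = R[i], derivatives are complex derivatives,
   so "C^infinity on U" is "holomorphic on U" (a holomorphic map is infinitely
   complex differentiable). *)
Fixpoint Ck_on (K : numFieldType) (V W : normedModType K) (k : nat)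
    (U : set V) (f : V -> W) : Prop :=
  match k with
  | 0%N => forall x, U x -> {for x, continuous f}
  | k'.+1 => (forall x, U x -> differentiable f x) /\
             (forall v : V, Ck_on k' U ('D_v f))
  end.

Definition smooth_on (K : numFieldType) (V W : normedModType K)
    (U : set V) (f : V -> W) : Prop :=
  forall k, Ck_on k U f.

(** * Manifolds *)

(* [cmap] is meaningful only on [cdom], and [cinv] only on [cmap @` cdom]. *)
Record chart (K : numFieldType) (T : topologicalType) (V : normedModType K) :=
  Chart { cdom : set T; cmap :> T -> V; cinv : V -> T }.

Definition is_chart (K : numFieldType) (T : topologicalType)
    (V : normedModType K) (c : chart T V) : Prop :=
  [/\ open (cdom c), open (c @` cdom c),
      forall p, cdom c p -> cinv c (c p) = p,
      forall p, cdom c p -> {for p, continuous c} &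
      forall x, (c @` cdom c) x -> {for x, continuous (cinv c)}].

(* An atlas is given as a choice of one chart around each point; the smooth
   structure is the one generated by these charts. *)
Definition is_atlas (K : numFieldType) (T : topologicalType)
    (V : normedModType K) (A : T -> chart T V) : Prop :=
  [/\ forall p, is_chart (A p), forall p, cdom (A p) p &
      forall p q, smooth_on (A p @` (cdom (A p) `&` cdom (A q)))
                            (A q \o cinv (A p))].

Definition prod_chart (K : numFieldType) (T S : topologicalType)
    (V W : normedModType K) (c : chart T V) (d : chart S W) :
    chart (T * S)%type (V * W)%type :=
  Chart (cdom c `*` cdom d) (fun z => (c z.1, d z.2))
        (fun w => (cinv c w.1, cinv d w.2)).

Definition prod_atlas (K : numFieldType) (T S : topologicalType)
    (V W : normedModType K) (A : T -> chart T V) (B : S -> chart S W)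
    (z : T * S) : chart (T * S)%type (V * W)%type :=
  prod_chart (A z.1) (B z.2).

Definition smooth_map (K : numFieldType) (T S : topologicalType)
    (V W : normedModType K) (A : T -> chart T V) (B : S -> chart S W)
    (F : T -> S) : Prop :=
  continuous F /\
  forall p q, smooth_on (A p @` (cdom (A p) `&` F @^-1` cdom (B q)))
                        (B q \o F \o cinv (A p)).

(* The differential of F at p, with the tangent spaces at p and F p identified
   with the model spaces through the charts c around p and d around F p. *)
Definition tangent_map (K : numFieldType) (T S : topologicalType)
    (V W : normedModType K) (c : chart T V) (d : chart S W)
    (F : T -> S) (p : T) : V -> W :=
  'd (d \o F \o cinv c) (c p).

Definition immersion (K : numFieldType) (T S : topologicalType)
    (V W : normedModType K) (A : T -> chart T V) (B : S -> chart S W)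
    (F : T -> S) : Prop :=
  smooth_map A B F /\
  forall p, injective (tangent_map (A p) (B (F p)) F p).

(** * The real manifold underlying a complex manifold *)

Definition realify (R : realType) (m : nat) (z : 'rV[R[i]]_m) : 'rV[R]_(m + m) :=
  row_mx (\row_j complex.Re (z 0 j)) (\row_j complex.Im (z 0 j)).

Definition complexify (R : realType) (m : nat) (w : 'rV[R]_(m + m)) :
    'rV[R[i]]_m :=
  \row_j (lsubmx w 0 j +i* rsubmx w 0 j).

Definition real_chart (R : realType) (T : topologicalType) (m : nat)
    (c : chart T 'rV[R[i]]_m) : chart T 'rV[R]_(m + m) :=
  Chart (cdom c) (@realify R m \o c) (cinv c \o @complexify R m).

(** * Lie groups *)

(* No compatibility is required here; continuity of the operations is part of
   their smoothness in [lieGroup]. *)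
#[short(type="preTopologicalGroupType")]
HB.structure Definition PreTopologicalGroup := {G of Topological G & Group G}.

(* Real Lie groups for K = R, complex Lie groups for K = R[i]. *)
Record lieGroup (K : numFieldType) (n : nat) := LieGroup {
  lie_sort :> preTopologicalGroupType;
  lie_atlas : lie_sort -> chart lie_sort 'rV[K]_n;
  lie_hausdorff : hausdorff_space lie_sort;
  lie_second_countable : second_countable (T := lie_sort);
  lie_atlasP : is_atlas lie_atlas;
  lie_mul_smooth : smooth_map (prod_atlas lie_atlas lie_atlas) lie_atlas
                     (fun z : lie_sort * lie_sort => (z.1 * z.2)%g);
  lie_inv_smooth : smooth_map lie_atlas lie_atlas (fun x : lie_sort => (x^-1)%g)
}.

Definition chart1 (K : numFieldType) (n : nat) (G : lieGroup K n) :
    chart G 'rV[K]_n :=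
  lie_atlas (1%g : G).

(* The Lie algebra of G is its tangent space at 1, identified with 'rV[K]_n
   through [chart1 G], with the bracket [X, Y] = ad X Y where ad is the
   differential at 1 of the adjoint representation Ad. *)
Definition Ad (K : numFieldType) (n : nat) (G : lieGroup K n) (p : G) :
    'rV[K]_n -> 'rV[K]_n :=
  tangent_map (chart1 G) (chart1 G) (fun q : G => (p * q * p^-1)%g) 1%g.

Definition bracket (K : numFieldType) (n : nat) (G : lieGroup K n)
    (X Y : 'rV[K]_n) : 'rV[K]_n :=
  'd ((fun p : G => Ad p Y) \o cinv (chart1 G)) (chart1 G 1%g) X.

(** * Left-invariant metrics and Wick rotations *)

(* A left-invariant metric is identified with its value at 1.
   K = R: pseudo-Riemannian Lie groups; K = R[i]: holomorphic Riemannian Lie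
   groups (the form is then complex bilinear, not sesquilinear). *)
Record metricLieGroup (K : numFieldType) (n : nat) := MetricLieGroup {
  mlie_group :> lieGroup K n;
  metric : {symmetric 'rV[K]_n};
  metric_nondegenerate : nondegenerate metric
}.

Notation pseudoRiemannianLieGroup R n := (@metricLieGroup R n) (only parsing).
Notation holoRiemannianLieGroup R n := (@metricLieGroup R[i] n) (only parsing).

(* The differential at 1, on Lie algebras, of a map into a complex Lie group
   regarded as a real one. *)
Definition lie_diff (R : realType) (n m : nat) (G : lieGroup R n)
    (GC : lieGroup R[i] m) (F : G -> GC) (X : 'rV[R]_n) : 'rV[R[i]]_m :=
  complexify (tangent_map (chart1 G) (real_chart (chart1 GC)) F 1%g X).

(* The last clause says that the Lie algebra of GC is h (+) i h, where h is the
   image of the differential, and that the differential is injective. *)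
Definition immersive_real_form (R : realType) (n m : nat) (G : lieGroup R n)
    (GC : lieGroup R[i] m) (F : G -> GC) : Prop :=
  [/\ {morph F : x y / (x * y)%g},
      immersion (@lie_atlas _ _ G) (fun p => real_chart (@lie_atlas _ _ GC p)) F
    & bijective (fun XY : 'rV[R]_n * 'rV[R]_n =>
        lie_diff F XY.1 + ('i)%C *: lie_diff F XY.2)].

(* Non-degeneracy of the restricted form is part of [metricLieGroup]. *)
Definition real_slice (R : realType) (n m : nat)
    (G : pseudoRiemannianLieGroup R n) (GC : holoRiemannianLieGroup R m)
    (F : G -> GC) : Prop :=
  immersive_real_form F /\
  forall X Y, metric GC (lie_diff F X) (lie_diff F Y) = (metric G X Y)%:C.

Definition wick_rotated (R : realType) (n n' : nat)
    (G : pseudoRiemannianLieGroup R n) (G' : pseudoRiemannianLieGroup R n') :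
    Prop :=
  exists (m : nat) (GC : holoRiemannianLieGroup R m)
         (F : G -> GC) (F' : G' -> GC),
    real_slice F /\ real_slice F'.

(** * Cartan involutions *)

Definition cartan_involution (R : realType) (n : nat)
    (G : pseudoRiemannianLieGroup R n)
    (theta : {linear 'rV[R]_n -> 'rV[R]_n}) : Prop :=
  [/\ forall X Y, theta (bracket G X Y) = bracket G (theta X) (theta Y),
      involutive theta,
      isometry (metric G) (metric G) theta &
      forall X, X != 0 -> 0 < metric G X (theta X)].

(* Main.v *)
(* Complexify the Cartan involution theta of g and compose it with the
   conjugation of g^C along g: this gives a conjugation tau with
   h(x, y) = g^C(x, tau y) positive definite.  If sigma is the conjugation along
   the other real form, then N = sigma tau is a complex linear automorphism of
   the bracket and of g^C which is self-adjoint for h, hence diagonalizable with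
   real nonzero eigenvalues.  Its sign S = N / |N| is again an automorphism of
   both, because eigenvalues multiply under the bracket and g^C only pairs
   inverse eigenvalues.  S commutes with sigma, and
   g^C(x, S sigma x) = h(|N|^(-1/2) x, |N|^(-1/2) x), so S restricts to a Cartan
   involution of the other real form.

   All of this uses only that both brackets are restrictions of a complex
   bilinear one.  In the chart at 1, with multiplication mu and inversion iota,
   Ad_x Y = D mu(x, iota x) (D mu(x, 1) (0, Y), 0), which is differentiable in x;
   so the bracket is bilinear, and F (p q p^-1) = F p F q (F p)^-1 can be
   differentiated in q and then in p. *)
From HB Require Import structures.
Require Import Defs.
From mathcomp Require Import all_boot all_order all_algebra sesquilinear complex.
From mathcomp Require Import all_classical all_reals all_analysis.
Set Implicit Arguments.
Unset Strict Implicit.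
Unset Printing Implicit Defensive.
Import Order.TTheory GRing.Theory Num.Theory numFieldNormedType.Exports.
Local Open Scope classical_set_scope.
Local Open Scope ring_scope.

(** Serves to bring a repeated root to the front of a list of roots, so that a double linear factor
    can be split off a polynomial. *)
Lemma not_uniq_perm (T : eqType) (s : seq T) :
  ~~ uniq s -> exists x s', perm_eq s [:: x, x & s'].
Proof.
elim: s => [//|y s IH] /=; rewrite negb_and negbK => /orP[ys|/IH[x [s' ss']]].
  by exists y, (rem y s); rewrite perm_cons; apply: perm_to_rem.
exists x, (y :: s'); rewrite -(perm_cons y) in ss'.
apply: perm_trans ss' _.
by rewrite (perm_catCA [:: y] [:: x; x] s').
Qed.

(** * Self-adjoint operators *)

Section SelfAdjoint.
Variables (C : numClosedFieldType) (m : nat) (A : 'M[C]_m).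
Variable h : 'rV[C]_m -> 'rV[C]_m -> C.
Hypothesis h_lin : forall y, scalar (h^~ y).
Hypothesis h_conj : forall x y, h y x = (h x y)^*.
Hypothesis h_pos : forall x, x != 0 -> 0 < h x x.
Hypothesis A_adj : forall x y, h (x *m A) y = h x (y *m A).

Let h0l y : h 0 y = 0.
Proof. by have := h_lin y (-1) 0 0; rewrite scaler0 addr0 mulN1r addNr. Qed.

Let hZl a x y : h (a *: x) y = a * h x y.
Proof. by have := h_lin y a x 0; rewrite h0l !addr0. Qed.

Let hBl x x' y : h (x - x') y = h x y - h x' y.
Proof. by rewrite addrC -scaleN1r h_lin mulN1r addrC. Qed.

Let hBr x y y' : h x (y - y') = h x y - h x y'.
Proof. by rewrite h_conj hBl rmorphB /= -!h_conj. Qed.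

Let hZr a x y : h x (a *: y) = a^* * h x y.
Proof. by rewrite h_conj hZl rmorphM /= -!h_conj. Qed.

Lemma selfadjoint_eigenvalue_real a : eigenvalue A a -> a \is Num.real.
Proof.
move=> /eigenvalueP[v vA v0]; apply/CrealP.
have := A_adj v v; rewrite vA hZl hZr => /esym.
by apply/mulIf; rewrite gt_eqF ?h_pos.
Qed.

(** For real a the operator A - a is again self-adjoint, so y = x(A - a) has h(y, y) = h(x, y(A -
    a)) = 0. This excludes Jordan blocks of size 2 or more. *)
Lemma selfadjoint_kernel2 a (x : 'rV[C]_m) : a \is Num.real ->
  x *m (A - a%:M) *m (A - a%:M) = 0 -> x *m (A - a%:M) = 0.
Proof.
move=> /CrealP ra; set y := x *m _ => y0; apply/eqP; apply: contraT => yn0.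
have := h_pos yn0; suff -> : h y y = h x (y *m (A - a%:M)).
  by rewrite y0 h_conj h0l rmorph0 ltxx.
by rewrite {1}/y !mulmxBr hBl hBr A_adj !mul_mx_scalar hZl hZr ra.
Qed.

End SelfAdjoint.

(** The minimal polynomial splits, and a double root a would allow one factor X - a to be dropped,
    against minimality. With simple roots A is diagonalizable, and the diagonal entries are real
    because they are eigenvalues. *)
Lemma selfadjoint_diagonalizable (C : numClosedFieldType) (m : nat)
    (A : 'M[C]_m) (h : 'rV[C]_m -> 'rV[C]_m -> C) :
    (forall y, scalar (h^~ y)) -> (forall x y, h y x = (h x y)^*) ->
    (forall x, x != 0 -> 0 < h x x) ->
    (forall x y, h (x *m A) y = h x (y *m A)) ->
  exists2 P : 'M[C]_m, P \in unitmx & exists d : 'rV[C]_m,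
    P *m A = diag_mx d *m P /\ forall i, d 0 i \is Num.real.
Proof.
move=> hl hc hp hA.
have [P Pu /diagonalizable_forPex[d /(simmxP Pu) PA]] : diagonalizable A.
  (* Size 0 is treated apart, since the minimal polynomial is formed for matrices of positive
     size. *)
  case: m => [|m] in A h hl hc hp hA *.
    by exists 1%:M; rewrite ?unitmx1 //; apply/is_diag_mxP => -[].
  apply/diagonalizableP.
  have [r /=] := closed_field_poly_normal (mxminpoly A).
  rewrite (monicP (mxminpoly_monic A)) scale1r => defp.
  exists r; last by rewrite defp.
  apply: contraT => /not_uniq_perm[a [s rs]].
  move: defp; rewrite (perm_big _ rs) !big_cons /=; set q := \prod_(z <- s) _ => defp.
  have ra : a \is Num.real.
    apply: (selfadjoint_eigenvalue_real hl hc hp hA).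
    by rewrite eigenvalue_root_min defp rootM root_XsubC eqxx.
  have hX : horner_mx A ('X - a%:P) = A - a%:M.
    by rewrite rmorphB /= horner_mx_X horner_mx_C.
  have hM p1 p2 : horner_mx A (p1 * p2) = horner_mx A p1 *m horner_mx A p2.
    exact: rmorphM.
  (* Each basis row times q(A) is killed by (A - a)^2, hence already by A - a. *)
  have q0 : horner_mx A (('X - a%:P) * q) = 0.
    apply/row_matrixP => i; rewrite row0 mulrC hM hX rowE mulmxA.
    apply: (selfadjoint_kernel2 hl hc hp hA ra).
    rewrite -!mulmxA -!hX -!hM.
    rewrite (_ : q * _ = mxminpoly A) ?mx_root_minpoly ?mulmx0 //.
    by rewrite defp mulrC mulrA.
  have qn0 : q != 0 by apply/monic_neq0/monic_prod_XsubC.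
  have Xn0 : 'X - a%:P != 0 by rewrite polyXsubC_eq0.
  (* The minimal polynomial (X - a)^2 q would divide (X - a) q, which has smaller degree. *)
  have := dvdp_leq _ (mxminpoly_min q0); rewrite defp mulf_neq0 // => /(_ isT).
  rewrite size_mul ?mulf_neq0 // size_XsubC /= ltnn.
  by [].
exists P => //; exists d; split=> // i.
apply: (selfadjoint_eigenvalue_real hl hc hp hA).
apply/eigenvalueP; exists (row i P).
  by rewrite -row_mul PA row_mul row_diag_mx -scalemxAl -rowE.
rewrite -row_free_unit in Pu.
apply/eqP => r0; have : delta_mx 0 i = 0 :> 'rV[C]_m.
  by apply: (row_free_inj Pu); rewrite mul0mx -rowE.
by move/matrixP/(_ 0 i)/eqP; rewrite !mxE !eqxx oner_eq0.
Qed.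

(* The first clause says that the eigenvectors of A span; M is f(A). *)
Lemma selfadjoint_calculus (C : numClosedFieldType) (m : nat)
    (A : 'M[C]_m) (h : 'rV[C]_m -> 'rV[C]_m -> C) :
    (forall y, scalar (h^~ y)) -> (forall x y, h y x = (h x y)^*) ->
    (forall x, x != 0 -> 0 < h x x) ->
    (forall x y, h (x *m A) y = h x (y *m A)) ->
  (forall Q : 'rV[C]_m -> Prop, Q 0 ->
     (forall a x y, Q x -> Q y -> Q (a *: x + y)) ->
     (forall a (x : 'rV[C]_m), a \is Num.real -> x *m A = a *: x -> Q x) ->
     forall x, Q x) /\
  (forall f : C -> C, exists M : 'M[C]_m,
     forall a (x : 'rV[C]_m), x *m A = a *: x -> x *m M = f a *: x).
Proof.
move=> hl hc hp hA.
have [P Pu [d [PA dr]]] := selfadjoint_diagonalizable hl hc hp hA.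
have AP : A *m invmx P = invmx P *m diag_mx d.
  by rewrite -[A](mulKmx Pu) PA -!mulmxA mulmxV // mulmx1.
split=> [Q Q0 QD Qe x|f].
  rewrite -(mulmxKV Pu x) mulmx_sum_row.
  elim/big_ind: _ => // [y z Qy Qz|i _].
    by rewrite -[y]scale1r; apply: QD.
  rewrite -[X in Q X]addr0; apply: QD => //; apply: (Qe (d 0 i)) => //.
  by rewrite -row_mul PA row_mul row_diag_mx -scalemxAl -rowE.
exists (invmx P *m diag_mx (map_mx f d) *m P) => a x xA.
apply: (can_inj (mulmxK (_ : invmx P \in unitmx))); first by rewrite unitmx_inv.
rewrite !mulmxA mulmxK // -scalemxAl; set c := x *m _.
(* In the eigenbasis the equation x A = a x says that each coordinate c_j is 0 or d_j = a; in both
   cases f(d_j) may be replaced by f(a). *)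
have : c *m diag_mx d = a *: c by rewrite /c -mulmxA -AP mulmxA xA -scalemxAl.
move: c => c /matrixP cd; apply/matrixP => i j; have := cd i j.
rewrite !mul_mx_diag !mxE; have [-> _|c0] := eqVneq (c i j) 0.
  by rewrite mul0r mulr0.
by rewrite mulrC => /(mulIf c0) <-; rewrite mulrC.
Qed.

(** * Real structures and real forms *)

(** A conjugation of the complex Lie algebra with bracket [B] and bilinear form [g]. Its fixed
    points are a real form, closed under [B], on which [g] is real valued. *)
Record real_structure (C : numClosedFieldType) (m : nat)
    (B : 'rV[C]_m -> 'rV[C]_m -> 'rV[C]_m) (g : 'rV[C]_m -> 'rV[C]_m -> C)
    (s : 'rV[C]_m -> 'rV[C]_m) : Prop := RealStructure {
  rs_antilinear : forall a x y, s (a *: x + y) = a^* *: s x + s y;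
  rs_involutive : involutive s;
  rs_morph : {morph s : x y / B x y};
  rs_form : forall x y, g (s x) (s y) = (g x y)^*
}.

(** All identities for S are linear or antilinear in each argument, so they are checked on
    eigenvectors of N = sigma tau, where S is the scalar a/|a|. The fixed points of [sigma] are the
    real form that is to receive a Cartan involution. *)
Lemma real_structure_sign (C : numClosedFieldType) (m : nat)
    (B : 'rV[C]_m -> 'rV[C]_m -> 'rV[C]_m) (g : 'rV[C]_m -> 'rV[C]_m -> C)
    (sigma tau : 'rV[C]_m -> 'rV[C]_m) :
    (forall x, linear (B x)) -> (forall y, linear (B^~ y)) ->
    (forall x, scalar (g x)) -> (forall x y, g x y = g y x) ->
    real_structure B g sigma -> real_structure B g tau ->
    (forall x, x != 0 -> 0 < g x (tau x)) ->
  exists S : {linear 'rV[C]_m -> 'rV[C]_m},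
    [/\ {morph S : x y / B x y}, involutive S,
        forall x y, g (S x) (S y) = g x y, forall x, sigma (S x) = S (sigma x) &
        forall x, x != 0 -> sigma x = x -> 0 < g x (S x)].
Proof.
move=> Br Bl gr gC [sL sK sB sg] [tL tK tB tg] gp.
have gl y : scalar (g^~ y) by move=> a u v; rewrite !(gC _ y) gr.
have N_lin : linear (sigma \o tau).
  by move=> a x y; rewrite /= tL sL conjCK.
pose N : {linear 'rV[C]_m -> 'rV[C]_m} :=
  HB.pack (sigma \o tau) (GRing.isLinear.Build _ _ _ _ _ N_lin).
pose A := lin1_mx N.
have AE x : x *m A = sigma (tau x) by rewrite mul_rV_lin1.
pose h x y := g x (tau y).
have hl y : scalar (h^~ y) by move=> a u v; apply: gl.
have hc x y : h y x = (h x y)^* by rewrite /h -tg tK gC.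
(* Applying [sigma] and then [tau] to both arguments of [g] conjugates its value twice, hence leaves
   it unchanged. *)
have hA x y : h (x *m A) y = h x (y *m A).
  by rewrite /h !AE -[tau y in LHS]sK sg -tg tK.
have [ind F] := selfadjoint_calculus hl hc gp hA.
have s0 : sigma 0 = 0.
  by have := sL (-1) 0 0; rewrite scaler0 addr0 rmorphN rmorph1 scaleN1r addNr.
have t0 : tau 0 = 0.
  by have := tL (-1) 0 0; rewrite scaler0 addr0 rmorphN rmorph1 scaleN1r addNr.
have sZ a x : sigma (a *: x) = a^* *: sigma x.
  by have := sL a x 0; rewrite s0 !addr0.
have tZ a x : tau (a *: x) = a^* *: tau x.
  by have := tL a x 0; rewrite t0 !addr0.
(* N is a composite of two involutions, so an eigenvector equation with eigenvalue 0 forces x = 0;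
   only nonzero real eigenvalues remain. *)
have eind (Q : 'rV[C]_m -> Prop) : Q 0 ->
    (forall a x y, Q x -> Q y -> Q (a *: x + y)) ->
    (forall a (x : 'rV[C]_m), a \is Num.real -> a != 0 -> x *m A = a *: x -> Q x) ->
    forall x, Q x.
  move=> Q0 QD Qe; apply: (ind Q) => // a x ar.
  have [->|a0] := eqVneq a 0; last exact: Qe ar a0.
  by rewrite AE scale0r => /(congr1 (tau \o sigma)) /=; rewrite sK tK s0 t0 => ->.
have Bl0 y : B 0 y = 0.
  by have := Bl y (-1) 0 0; rewrite scaler0 addr0 scaleN1r addNr.
have Br0 x : B x 0 = 0.
  by have := Br x (-1) 0 0; rewrite scaler0 addr0 scaleN1r addNr.
have gl0 y : g 0 y = 0.
  by have := gl y (-1) 0 0; rewrite scaler0 addr0 mulN1r addNr.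
have gr0 x : g x 0 = 0 by rewrite gC gl0.
have BZ a b x y : B (a *: x) (b *: y) = (a * b) *: B x y.
  have := Bl (b *: y) a x 0; rewrite Bl0 !addr0 => ->.
  by have := Br x b y 0; rewrite Br0 !addr0 => ->; rewrite scalerA.
have gZ a b x y : g (a *: x) (b *: y) = a * b * g x y.
  have := gl (b *: y) a x 0; rewrite gl0 !addr0 => ->.
  by have := gr x b y 0; rewrite gr0 !addr0 => ->; rewrite mulrA.
(* Num.sg is known to be multiplicative only on a realDomainType. *)
pose f (a : C) := a / `|a|.
have fM a b : f (a * b) = f a * f b by rewrite /f normrM invfM mulrACA.
have fV a : f a^-1 = (f a)^-1 by rewrite /f normfV -invfM.
have f2 a : a \is Num.real -> a != 0 -> f a * f a = 1.
  by move=> ar a0; rewrite -fM /f -expr2 normrX real_normK // divff ?expf_neq0.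
have [M MP] := F f; pose S : {linear 'rV[C]_m -> 'rV[C]_m} := mulmxr M.
have SE a x : x *m A = a *: x -> S x = f a *: x by exact: MP.
have N_morph x y : B x y *m A = B (x *m A) (y *m A) by rewrite !AE tB sB.
have N_form x y : g (x *m A) (y *m A) = g x y by rewrite !AE sg tg conjCK.
(* Conjugation by [sigma] turns sigma tau into tau sigma, the inverse of N, and keeps real
   scalars. *)
have sA a x : a \is Num.real -> a != 0 -> x *m A = a *: x ->
    sigma x *m A = a^-1 *: sigma x.
  move=> /CrealP ar a0; rewrite !AE => /(congr1 (tau \o sigma)) /=.
  rewrite sK tK sZ tZ conjCK => xE.
  by rewrite [in RHS]xE sZ ar scalerA mulVf // scale1r.
exists S; split.
- elim/eind => [y||a x ar a0 xA].
  + by rewrite Bl0 linear0 Bl0.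
  + by move=> a x1 x2 H1 H2 y; rewrite Bl !linearP Bl H1 H2.
  elim/eind => [||b y br b0 yA].
  + by rewrite Br0 linear0 Br0.
  + by move=> b y1 y2 H1 H2; rewrite Br !linearP Br H1 H2.
  (* [B x y] may vanish; [SE] asks only for the eigenvector equation, which then still holds. *)
  have BA : B x y *m A = (a * b) *: B x y by rewrite N_morph xA yA BZ.
  by rewrite (SE _ _ xA) (SE _ _ yA) BZ (SE _ _ BA) fM.
- elim/eind => [|a x1 x2 H1 H2|a x ar a0 xA]; first by rewrite !linear0.
    by rewrite !linearP H1 H2.
  by rewrite (SE _ _ xA) linearZZ (SE _ _ xA) scalerA f2 ?scale1r.
- elim/eind => [y||a x ar a0 xA].
  + by rewrite linear0 !gl0.
  + by move=> a x1 x2 H1 H2 y; rewrite linearP !gl H1 H2.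
  elim/eind => [||b y br b0 yA].
  + by rewrite linear0 !gr0.
  + by move=> b y1 y2 H1 H2; rewrite linearP !gr H1 H2.
  rewrite (SE _ _ xA) (SE _ _ yA) gZ.
  have := N_form x y; rewrite xA yA gZ; have [->|gn0] := eqVneq (g x y) 0.
    by rewrite !mulr0.
  by rewrite -[RHS]mul1r => /(mulIf gn0) ab; rewrite -fM ab /f normr1 divr1 mul1r.
- elim/eind => [|a x1 x2 H1 H2|a x ar a0 xA]; first by rewrite s0 !linear0 s0.
    by rewrite linearP !sL linearP H1 H2.
  (* The eigenvalues a of x and 1/a of [sigma x] have the same sign, and a sign is its own
     conjugate. *)
  rewrite (SE _ _ xA) (SE _ _ (sA _ _ ar a0 xA)) fV sZ.
  congr (_ *: _); rewrite conj_Creal ?rpredM ?rpredV ?normr_real //.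
  have fn0 : f a != 0 by rewrite mulf_neq0 ?invr_eq0 ?normr_eq0.
  by apply: (mulIf fn0); rewrite f2 // mulVf.
(* M' is |N|^(-1/2). *)
have [M' M'P] := F (fun a => (sqrtC `|a|)^-1).
have hT x y : g x (S (sigma y)) = h (x *m M') (y *m M').
  rewrite /h; elim/eind: y x => [x||b y br b0 yA].
  + by rewrite s0 linear0 mul0mx t0 !gr0.
  + move=> b y1 y2 H1 H2 x.
    by rewrite sL linearP gr mulmxDl -scalemxAl tL gr H1 H2.
  elim/eind => [||a x ar a0 xA].
  + by rewrite mul0mx !gl0.
  + by move=> a x1 x2 H1 H2; rewrite gl mulmxDl -scalemxAl gl H1 H2.
  have tyE : sigma y = b^-1 *: tau y.
    have := yA; rewrite AE => /(congr1 sigma); rewrite sK sZ (CrealP br) => ->.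
    by rewrite scalerA mulVf // scale1r.
  rewrite (SE _ _ (sA _ _ br b0 yA)) (M'P _ _ xA) (M'P _ _ yA) tyE scalerA tZ.
  rewrite -[x in LHS]scale1r !gZ mul1r.
  (* Self-adjointness gives a h(x, y) = b h(x, y). So either both sides are 0, or a = b and both
     sides carry the factor 1/|b|. *)
  have := hA x y; rewrite /h xA yA.
  rewrite -[y in g (a *: x) (tau y)]scale1r -[x in _ = g x _]scale1r !tZ !gZ.
  have [->|gn0] := eqVneq (g x (tau y)) 0; first by rewrite !mulr0.
  move=> /(mulIf gn0); rewrite conjC1 mulr1 mul1r (CrealP br) => ab; congr (_ * _).
  rewrite ab fV conj_Creal ?rpredV ?ger0_real ?sqrtC_ge0 // -!invfM -expr2 sqrtCK.
  by rewrite /f mulrAC -expr2 -real_normK // expr2 mulfK ?normr_eq0.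
move=> x x0 sx; rewrite -[x in S x]sx hT; apply: gp; apply: contra x0 => /eqP xM.
(* M2 is |N|^(1/2). It inverts M', which is therefore injective. *)
have [M2 M2P] := F (fun a => sqrtC `|a|).
have M2K : forall z : 'rV[C]_m, z *m M' *m M2 = z.
  elim/eind => [|a x1 x2 H1 H2|a y ar a0 yA]; first by rewrite !mul0mx.
    by rewrite !mulmxDl -!scalemxAl H1 H2.
  rewrite (M'P _ _ yA) -scalemxAl (M2P _ _ yA) scalerA mulVf ?scale1r //.
  by rewrite sqrtC_eq0 normr_eq0.
by rewrite -(M2K x) xM mul0mx.
Qed.

(** * Bracket, metric and conjugations in coordinates along a real form *)

Section RealForm.
Variables (R : rcfType) (n m : nat).
Variables (B : 'rV[R[i]]_m -> 'rV[R[i]]_m -> 'rV[R[i]]_m).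
Variables (g : 'rV[R[i]]_m -> 'rV[R[i]]_m -> R[i]).
Variables (b : 'rV[R]_n -> 'rV[R]_n -> 'rV[R]_n) (k : 'rV[R]_n -> 'rV[R]_n -> R).
Variable phi : 'rV[R]_n -> 'rV[R[i]]_m.
Hypotheses (Br : forall x, linear (B x)) (Bl : forall y, linear (B^~ y)).
Hypotheses (gr : forall x, scalar (g x)) (gC : forall x y, g x y = g y x).
Hypothesis phi_lin : forall a X Y, phi (a *: X + Y) = a%:C%C *: phi X + phi Y.
Hypothesis phi_bij :
  bijective (fun XY : 'rV[R]_n * 'rV[R]_n => phi XY.1 + ('i)%C *: phi XY.2).
Hypothesis phi_B : forall X Y, B (phi X) (phi Y) = phi (b X Y).
Hypothesis phi_g : forall X Y, g (phi X) (phi Y) = (k X Y)%:C%C.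

Lemma real_form0 : phi 0 = 0.
Proof.
by have := phi_lin (-1) 0 0; rewrite scaler0 addr0 rmorphN rmorph1 scaleN1r addNr.
Qed.

Lemma real_formD X Y : phi (X + Y) = phi X + phi Y.
Proof. by rewrite -[X]scale1r phi_lin rmorph1 !scale1r. Qed.

Lemma real_formZ a X : phi (a *: X) = a%:C%C *: phi X.
Proof. by rewrite -[a *: X]addr0 phi_lin real_form0 addr0. Qed.

Lemma real_form_pairD X Y X' Y' :
  phi X + ('i)%C *: phi Y + (phi X' + ('i)%C *: phi Y') =
  phi (X + X') + ('i)%C *: phi (Y + Y').
Proof. by rewrite addrACA -scalerDr -!real_formD. Qed.

Lemma real_formN X : phi (- X) = - phi X.
Proof. by rewrite -scaleN1r real_formZ rmorphN rmorph1 scaleN1r. Qed.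

Lemma real_form_inj X Y X' Y' :
  phi X + ('i)%C *: phi Y = phi X' + ('i)%C *: phi Y' -> X = X' /\ Y = Y'.
Proof. by move=> /(bij_inj phi_bij (x1 := (X, Y)) (x2 := (X', Y'))) []. Qed.

Lemma real_form_surj x : exists X Y, x = phi X + ('i)%C *: phi Y.
Proof. by have [f _ fK] := phi_bij; exists (f x).1, (f x).2; rewrite fK. Qed.

Lemma real_formZc (z : R[i]) X Y :
  z *: (phi X + ('i)%C *: phi Y) =
  phi (complex.Re z *: X - complex.Im z *: Y) +
  ('i)%C *: phi (complex.Im z *: X + complex.Re z *: Y).
Proof.
rewrite !real_formD real_formN !real_formZ {1}[z]complexE.
set u := (complex.Re z)%:C%C; set v := (complex.Im z)%:C%C.
have ii : ('i)%C * ('i)%C = -1 :> R[i] by rewrite complexiE -expr2 sqrCi.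
rewrite !scalerDr !scalerDl !scalerA -[_ * v * _]mulrA [v * _]mulrC mulrA ii mulN1r.
rewrite [u * _]mulrC scaleNr -!addrA; congr (_ + _).
by rewrite addrA addrC.
Qed.

Let ii : ('i)%C * ('i)%C = -1 :> R[i].
Proof. by rewrite complexiE -expr2 sqrCi. Qed.

Let BD x x' y y' : B (x + ('i)%C *: x') (y + ('i)%C *: y') =
  B x y - B x' y' + ('i)%C *: (B x y' + B x' y).
Proof.
rewrite addrC [y + _]addrC Bl !Br scalerDr scalerA ii scaleN1r scalerDr.
by rewrite [LHS]addrC [X in X + _ = _]addrC addrACA.
Qed.

Let gl y : scalar (g^~ y).
Proof. by move=> a u v; rewrite !(gC _ y) gr. Qed.

Let gD x x' y y' : g (x + ('i)%C *: x') (y + ('i)%C *: y') =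
  g x y - g x' y' + ('i)%C * (g x y' + g x' y).
Proof.
rewrite addrC [y + _]addrC gl !gr mulrDr mulrA ii mulN1r mulrDr.
by rewrite [LHS]addrC [X in X + _ = _]addrC addrACA.
Qed.

Lemma real_form_bracket X Y X' Y' :
  B (phi X + ('i)%C *: phi Y) (phi X' + ('i)%C *: phi Y') =
  phi (b X X' - b Y Y') + ('i)%C *: phi (b X Y' + b Y X').
Proof. by rewrite BD !real_formD real_formN !phi_B. Qed.

Lemma real_form_metric X Y X' Y' :
  g (phi X + ('i)%C *: phi Y) (phi X' + ('i)%C *: phi Y') =
  ((k X X' - k Y Y') +i* (k X Y' + k Y X'))%C.
Proof. by rewrite gD !phi_g [RHS]complexE /= rmorphB rmorphD. Qed.

Let phi_inj : injective phi.
Proof.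
move=> X X' e; apply: (proj1 (real_form_inj (Y := 0) (Y' := 0) _)).
by rewrite e.
Qed.

(** The bracket [b] is known only through [phi]; its sign rules are pulled back from those of [B]
    along the injective [phi]. *)
Let bNl X Y : b (- X) Y = - b X Y.
Proof.
apply: phi_inj; rewrite -phi_B !real_formN -phi_B.
have B0 : B 0 (phi Y) = 0.
  by have := Bl (phi Y) (-1) 0 0; rewrite scaler0 addr0 scaleN1r addNr.
by have := Bl (phi Y) (-1) (phi X) 0; rewrite B0 !addr0 !scaleN1r.
Qed.

Let bNr X Y : b X (- Y) = - b X Y.
Proof.
apply: phi_inj; rewrite -phi_B !real_formN -phi_B.
have B0 : B (phi X) 0 = 0.
  by have := Br (phi X) (-1) 0 0; rewrite scaler0 addr0 scaleN1r addNr.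
by have := Br (phi X) (-1) (phi Y) 0; rewrite B0 !addr0 !scaleN1r.
Qed.

Lemma real_form_metricN X Y : k (- X) Y = - k X Y.
Proof.
apply: (@complexI R); rewrite rmorphN /= -!phi_g !real_formN.
have g0 : g 0 (phi Y) = 0.
  by have := gl (phi Y) (-1) 0 0; rewrite scaler0 addr0 mulN1r addNr.
by have := gl (phi Y) (-1) (phi X) 0; rewrite g0 !addr0 scaleN1r mulN1r.
Qed.

Lemma real_form_metricC X Y : k X Y = k Y X.
Proof. by apply: (@complexI R); rewrite -!phi_g gC. Qed.

(** The antilinear extension of [theta], that is, its complexification composed with the conjugation
    along the real form. The identity as [theta] yields the conjugation itself. *)
Lemma real_form_structure (theta : {linear 'rV[R]_n -> 'rV[R]_n}) :
    {morph theta : X Y / b X Y} -> involutive theta ->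
    (forall X Y, k (theta X) (theta Y) = k X Y) ->
  exists s, real_structure B g s /\
    forall X Y, s (phi X + ('i)%C *: phi Y) =
                phi (theta X) + ('i)%C *: phi (- theta Y).
Proof.
move=> tB tK tk; have [f fK Kf] := phi_bij.
have [s sE] : exists s, forall X Y, s (phi X + ('i)%C *: phi Y) =
    phi (theta X) + ('i)%C *: phi (- theta Y).
  exists (fun x => phi (theta (f x).1) + ('i)%C *: phi (- theta (f x).2)) => X Y.
  by rewrite (fK (X, Y)).
exists s; split=> //; split.
- move=> a x y; have [X [Y ->]] := real_form_surj x.
  have [X' [Y' ->]] := real_form_surj y.
  rewrite real_formZc real_form_pairD !sE real_formZc real_form_pairD.
  have [-> ->] : complex.Re a^* = complex.Re a /\ complex.Im a^* = - complex.Im a.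
    by case: a.
  congr (phi _ + _ *: phi _).
    by rewrite linearD linearB !linearZ /= scaleNr scalerN opprK.
  by rewrite !linearD !linearZ /= scaleNr scalerN.
- move=> x; have [X [Y ->]] := real_form_surj x.
  by rewrite !sE linearN /= !tK opprK.
- move=> x y; have [X [Y ->]] := real_form_surj x.
  have [X' [Y' ->]] := real_form_surj y.
  rewrite real_form_bracket !sE real_form_bracket; congr (phi _ + _ *: phi _).
    by rewrite linearB /= !tB bNl bNr opprK.
  by rewrite linearD /= !tB bNl bNr opprD.
- move=> x y; have [X [Y ->]] := real_form_surj x.
  have [X' [Y' ->]] := real_form_surj y.
  rewrite real_form_metric !sE real_form_metric.
  rewrite !real_form_metricN ![k (theta _) (- _)]real_form_metricC.
  rewrite !real_form_metricN ![k (theta _) (theta _)]tk.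
  by rewrite opprK -opprD ![k Y' _]real_form_metricC.
Qed.
End RealForm.

(** The algebraic core, for two real forms of one complex Lie algebra: [tau] extends [theta] from
    the first form, [sigma] is the conjugation along the second, and the sign S of sigma tau
    restricts to the second form because it commutes with [sigma]. *)
Lemma cartan_transfer (R : rcfType) (n n' m : nat)
    (B : 'rV[R[i]]_m -> 'rV[R[i]]_m -> 'rV[R[i]]_m)
    (g : 'rV[R[i]]_m -> 'rV[R[i]]_m -> R[i])
    (b : 'rV[R]_n -> 'rV[R]_n -> 'rV[R]_n) (k : 'rV[R]_n -> 'rV[R]_n -> R)
    (b' : 'rV[R]_n' -> 'rV[R]_n' -> 'rV[R]_n') (k' : 'rV[R]_n' -> 'rV[R]_n' -> R)
    (phi : 'rV[R]_n -> 'rV[R[i]]_m) (phi' : 'rV[R]_n' -> 'rV[R[i]]_m)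
    (theta : {linear 'rV[R]_n -> 'rV[R]_n}) :
    (forall x, linear (B x)) -> (forall y, linear (B^~ y)) ->
    (forall x, scalar (g x)) -> (forall x y, g x y = g y x) ->
    (forall a X Y, phi (a *: X + Y) = a%:C%C *: phi X + phi Y) ->
    bijective (fun XY : 'rV[R]_n * 'rV[R]_n => phi XY.1 + ('i)%C *: phi XY.2) ->
    (forall X Y, B (phi X) (phi Y) = phi (b X Y)) ->
    (forall X Y, g (phi X) (phi Y) = (k X Y)%:C%C) ->
    (forall a X Y, phi' (a *: X + Y) = a%:C%C *: phi' X + phi' Y) ->
    bijective (fun XY : 'rV[R]_n' * 'rV[R]_n' => phi' XY.1 + ('i)%C *: phi' XY.2) ->
    (forall X Y, B (phi' X) (phi' Y) = phi' (b' X Y)) ->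
    (forall X Y, g (phi' X) (phi' Y) = (k' X Y)%:C%C) ->
    {morph theta : X Y / b X Y} -> involutive theta ->
    (forall X Y, k (theta X) (theta Y) = k X Y) ->
    (forall X, X != 0 -> 0 < k X (theta X)) ->
  exists theta' : {linear 'rV[R]_n' -> 'rV[R]_n'},
    [/\ {morph theta' : X Y / b' X Y}, involutive theta',
        forall X Y, k' (theta' X) (theta' Y) = k' X Y &
        forall X, X != 0 -> 0 < k' X (theta' X)].
Proof.
move=> Br Bl gr gC pl pb pB pg pl' pb' pB' pg' tB tK tk tp.
have [tau [tauS tauE]] := real_form_structure Br Bl gr gC pl pb pB pg tB tK tk.
have [sigma [sigmaS sigmaE]] := real_form_structure Br Bl gr gC pl' pb' pB' pg'
  (theta := idfun) (fun _ _ => erefl) (fun _ => erefl) (fun _ _ => erefl).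
have kC := real_form_metricC gC pg.
have kN := real_form_metricN gr gC pl pg.
have tau_pos x : x != 0 -> 0 < g x (tau x).
  have [X [Y ->]] := real_form_surj pb x; rewrite tauE => xn0.
  rewrite (real_form_metric gr gC pg) ![k _ (- _)]kC !kN ![k (theta Y) _]kC opprK.
  (* The imaginary part vanishes, since an isometric involution is self-adjoint for [k]. What is
     left is k(X, theta X) + k(Y, theta Y). *)
  have -> : k Y (theta X) = k X (theta Y) by rewrite kC -[RHS]tk tK.
  rewrite addNr complexr0 ltcR.
  have t0 : k 0 (theta 0) = 0.
    rewrite linear0; apply: (@complexI R); rewrite -pg (real_form0 pl).
    by have := gr 0 (-1) 0 0; rewrite scaler0 addr0 mulN1r addNr.
  have tge Z : 0 <= k Z (theta Z).
    by have [->|/tp/ltW//] := eqVneq Z 0; rewrite t0.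
  have [X0|X0] := eqVneq X 0; last by rewrite ltr_pwDl ?tp.
  rewrite ltr_wpDl // tp //; apply: contra xn0 => /eqP ->.
  by rewrite X0 (real_form0 pl) scaler0 addr0.
have [S [SB SK Sg SC Sp]] := real_structure_sign Br Bl gr gC sigmaS tauS tau_pos.
have [f fK Kf] := pb'.
have inj' X Y : phi' X = phi' Y -> X = Y.
  move=> e; apply: (proj1 (real_form_inj pb' (Y := 0) (Y' := 0) _)).
  by rewrite e.
have sigma_phi X : sigma (phi' X) = phi' X.
  have := sigmaE X 0; rewrite /= oppr0 (real_form0 pl') scaler0 !addr0.
  exact.
pose th X := (f (S (phi' X))).1.
(* [S (phi' X)] is fixed by [sigma], so its imaginary component equals its own negative and is 0;
   the real component taken by [th] is all of it. *)
have thE X : phi' (th X) = S (phi' X).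
  have := SC (phi' X); rewrite sigma_phi -(Kf (S (phi' X))) sigmaE /= -/(th X).
  move=> /(real_form_inj pb')[_ /eqP].
  rewrite -subr_eq0 -opprD oppr_eq0 -mulr2n -scaler_nat scaler_eq0 pnatr_eq0 /=.
  by move=> /eqP ->; rewrite (real_form0 pl') scaler0 addr0.
have th_lin : linear th.
  by move=> a X Y; apply: inj'; rewrite pl' !thE pl' linearP.
exists (HB.pack_for {linear 'rV[R]_n' -> 'rV[R]_n'} th
  (GRing.isLinear.Build _ _ _ _ _ th_lin)).
split=> /= [X Y|X|X Y|X X0].
- by apply: inj'; rewrite -pB' !thE -pB' SB.
- by apply: inj'; rewrite !thE SK.
- by apply: (@complexI R); rewrite -!pg' !thE Sg.
rewrite -ltcR -pg' thE; apply: Sp => //; apply: contra X0 => /eqP X0.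
by apply/eqP/inj'; rewrite X0 (real_form0 pl').
Qed.
(** * Differentiable maps *)

Section Differentiability.
Context (K : numFieldType) (V W : normedModType K).
Implicit Types (f g : V -> W) (x : V).

(** The epsilon form of the derivative can be compared across the two scalar fields [R] and [R[i]],
    whose little-o statements concern different normed modules. *)
Lemma is_diff_epsP f x (L : {linear V -> W}) : continuous L ->
    (forall e, 0 < e ->
      \forall h \near (0 : V), `|f (h + x) - f x - L h| <= e * `|h|) ->
  is_diff x f L.
Proof.
move=> cL fL; have fE : f \o shift x = cst (f x) + L +o_ (0 : V) id.
  apply/eqaddoP => e /fL; apply: filterS => h /=.
  by rewrite /= opprD addrA.
have dE := diff_unique cL fE.
by apply: DiffDef => //; apply/diff_locallyP; rewrite dE.
Qed.

Lemma differentiable_eps f x : differentiable f x -> forall e, 0 < e ->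
  \forall h \near (0 : V), `|f (h + x) - f x - 'd f x h| <= e * `|h|.
Proof.
move=> /diff_locally /eqaddoP fE e /fE; apply: filterS => h /=.
by rewrite /= opprD addrA.
Qed.

Lemma near_eq_is_diff f g x : (\forall y \near x, f y = g y) ->
  differentiable f x -> is_diff x g ('d f x).
Proof.
move=> fg df; apply: is_diff_epsP; first exact: diff_continuous.
move=> e e0.
have fg0 : \forall h \near (0 : V), f (h + x) = g (h + x).
  by move: fg; rewrite (near_shift 0 x) subr0.
apply: filterS2 fg0 (differentiable_eps df e0) => h /= <-.
by rewrite (nbhs_singleton fg).
Qed.

Lemma near_eq_differentiable f g x : (\forall y \near x, f y = g y) ->
  differentiable f x -> differentiable g x.
Proof. by move=> fg /(near_eq_is_diff fg) []. Qed.

Lemma near_eq_diff f g x : (\forall y \near x, f y = g y) ->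
  differentiable f x -> 'd f x = 'd g x :> (V -> W).
Proof. by move=> fg /(near_eq_is_diff fg) E; rewrite (@diff_val _ _ _ _ _ _ _ E). Qed.

(** Differentiates an equality of germs; the homomorphism identities are later carried to tangent
    spaces in this way. *)
Lemma near_eq_is_diff_unique f g (df dg : V -> W) x :
  (\forall y \near x, f y = g y) -> is_diff x f df -> is_diff x g dg -> df = dg.
Proof.
move=> fg fdf gdg; rewrite -(@diff_val _ _ _ _ _ _ _ fdf).
rewrite -(@diff_val _ _ _ _ _ _ _ gdg).
by apply: near_eq_diff fg _; exact: ex_diff.
Qed.

Lemma linear_is_diff (L : {linear V -> W}) x : continuous L -> is_diff x L L.
Proof.
by move=> cL; apply: DiffDef; [exact: linear_differentiable | exact: diff_lin].
Qed.

Lemma diff_linear_combination f g x a v :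
  differentiable f x -> differentiable g x ->
  'd (fun y => a *: f y + g y) x v = a *: 'd f x v + 'd g x v.
Proof.
move=> df dg; have := diffD (differentiableZ a df) dg.
by rewrite diffZ // => /(congr1 (fun h : V -> W => h v)).
Qed.

End Differentiability.

(** * Sup norms and the passage between complex and real coordinates *)

Lemma mx_coord_le_norm (K : numFieldType) (m n : nat) (M : 'M[K]_(m, n)) i j :
  `|M i j| <= `|M|.
Proof.
rewrite [leRHS]/Num.Def.normr /= mx_normE.
rewrite -[leLHS]nngE num_le.
exact: (le_bigmax _ (fun i : 'I_m * 'I_n => `|M i.1 i.2|%:nng) (i, j)).
Qed.

Lemma mx_norm_le (K : numFieldType) (m n : nat) (M : 'M[K]_(m, n)) (a : K) :
  0 <= a -> (forall i j, `|M i j| <= a) -> `|M| <= a.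
Proof.
move=> a0 Ma; rewrite [leLHS]/Num.Def.normr /= mx_normE.
rewrite -[leRHS]/((NngNum a0)%:num) num_le; apply/bigmax_leP; split=> //=.
move=> i _; rewrite -num_le /=; exact: Ma.
Qed.

Section RealComplex.
Variables (R : realType) (m : nat).
Local Notation C := R[i].
Local Notation realify := (@realify R m).
Local Notation complexify := (@complexify R m).

Lemma realifyK : cancel realify complexify.
Proof.
move=> z; apply/matrixP => i j; rewrite mxE ord1 row_mxKl row_mxKr !mxE.
by case: (z 0 j).
Qed.

Lemma complexifyK : cancel complexify realify.
Proof.
move=> w; rewrite /realify -[RHS]hsubmxK.
by congr row_mx; apply/matrixP => i j; rewrite !mxE ord1.
Qed.

Lemma complexify_linear a x y :
  complexify (a *: x + y) = a%:C%C *: complexify x + complexify y.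
Proof.
apply/matrixP => i j; rewrite !mxE /=; apply/eqP.
by rewrite eq_complex /= !mul0r subr0 addr0 !eqxx.
Qed.

Lemma realify_linear a x y :
  realify (a%:C%C *: x + y) = a *: realify x + realify y.
Proof. by apply: (can_inj complexifyK); rewrite complexify_linear !realifyK. Qed.

Lemma realifyB x y : realify (x - y) = realify x - realify y.
Proof.
have := realify_linear (-1) y x.
by rewrite rmorphN rmorph1 !scaleN1r addrC => ->; rewrite addrC.
Qed.

Lemma realify_norm z : (`|realify z|)%:C%C <= `|z|.
Proof.
have rz : `|z| \is Num.real by apply: normr_real.
rewrite -(RRe_real rz) lecR; apply: mx_norm_le.
  by rewrite -ler0c RRe_real.
move=> i j; rewrite -lecR RRe_real //; rewrite ord1 -(splitK j) {i}.
case: (fintype.split j) => {}j /=.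
  rewrite row_mxEl mxE; apply: le_trans (mx_coord_le_norm z 0 j).
  by rewrite (le_trans _ (normc_ge_Re _)) // .
rewrite row_mxEr mxE; apply: le_trans (mx_coord_le_norm z 0 j).
(* The imaginary part of c is minus the real part of i c, and i c has the same modulus as c. *)
move: (z 0 j) => c; have := normc_ge_Re (('i)%C * c).
have -> : complex.Re (('i)%C * c) = - complex.Im c.
  by case: c => u v /=; rewrite mul0r mul1r sub0r.
by rewrite normrN normrM complexiE normCi mul1r.
Qed.

(** The constant 2 comes from |u + i v| <= |u| + |v|, with both terms bounded by the sup norm. *)
Lemma complexify_norm w : `|complexify w| <= (2 * `|w|)%:C%C.
Proof.
apply: mx_norm_le; first by rewrite ler0c mulr_ge0.
move=> i j; rewrite mxE [(_ +i* _)%C]complexE; apply: le_trans (ler_normD _ _) _.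
rewrite normrM complexiE normCi mul1r /=.
have nC (x : R) : `|x%:C%C| = (`|x|)%:C%C.
  by rewrite normc_def /= expr0n addr0 sqrtr_sqr.
rewrite !nC -rmorphD lecR mulr2n mulrDl !mul1r lerD // !mxE; exact: mx_coord_le_norm.
Qed.
End RealComplex.

(** A complex derivative is a real one: the norm bounds for [realify] and [complexify] carry the
    epsilon estimate over. *)
Lemma realify_is_diff (R : realType) (m p : nat)
    (f : 'rV[R[i] : numFieldType]_m -> 'rV[R[i] : numFieldType]_p)
    (w : 'rV[R]_(m + m)) :
  differentiable f (complexify w : 'rV[R[i] : numFieldType]_m) ->
  is_diff w (@realify R p \o f \o @complexify R m)
    (@realify R p \o 'd f (complexify w : 'rV[R[i] : numFieldType]_m) \o @complexify R m).
Proof.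
set w' : 'rV[R[i] : numFieldType]_m := complexify w; move=> df.
have [k k0 kf] := linear_lipschitz (diff_continuous df).
have fE := differentiable_eps df.
move: ('d f w') k0 kf fE => A k0 kf fE.
set L := _ \o A \o _.
have L_lin : linear L.
  by move=> a x y; rewrite /L /= complexify_linear linearP realify_linear.
pose LL : {linear 'rV[R]_(m + m) -> 'rV[R]_(p + p)} :=
  HB.pack L (GRing.isLinear.Build _ _ _ _ _ L_lin).
have two : 2 = 2%:C%C :> R[i] by rewrite rmorph_nat.
have compl (x : 'rV[R]_(m + m)) : `|complexify x| <= 2 * (`|x|)%:C%C.
  by rewrite (le_trans (complexify_norm x)) // rmorphM rmorph_nat.
(* Norms over [R[i]] take values in [R[i]]; positive elements are real, so [complex.Re] brings the
   bounds down to [R]. *)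
have kr : (complex.Re k)%:C%C = k by apply: RRe_real; rewrite gtr0_real.
have cL : continuous LL.
  apply: bounded_linear_continuous; apply/linear_boundedP.
  exists (complex.Re k * 2); split; first exact: num_real.
  move=> r kr2 x; rewrite /= /L /= -lecR; apply: le_trans (realify_norm _) _ => /=.
  apply: le_trans (kf _) _; rewrite rmorphM.
  apply: le_trans (ler_wpM2l (ltW k0) (compl x)) _.
  rewrite mulrA ler_wpM2r ?ler0c // -kr two.
  by rewrite -rmorphM lecR ltW.
apply: (is_diff_epsP (L := LL) cL) => e e0.
(* Halving e, and below the radius d, absorbs the factor 2 lost by [complexify]. *)
have e0' : 0 < (e / 2)%:C%C :> R[i] by rewrite ltcR divr_gt0.
have /nbhs_ballP[d d0 dP] := fE _ e0'.
have dr : (complex.Re d)%:C%C = d by apply: RRe_real; rewrite gtr0_real.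
have d0' : 0 < complex.Re d / 2 by rewrite divr_gt0 // -ltcR dr.
apply/nbhs_ballP; exists (complex.Re d / 2) => //= x.
rewrite -ball_normE /= sub0r normrN => xd.
have /dP /= : ball 0 d (complexify x).
  rewrite -ball_normE /= sub0r normrN; apply: le_lt_trans (compl x) _.
  by rewrite -dr two -rmorphM ltcR mulrC -ltr_pdivlMr.
rewrite /L /= => dx; rewrite -lecR.
have -> : complexify (x + w) = complexify x + complexify w.
  by rewrite -[x]scale1r complexify_linear rmorph1 !scale1r.
rewrite -!realifyB; apply: le_trans (realify_norm _) _; apply: (le_trans dx).
apply: le_trans (ler_wpM2l (ltW e0') (compl x)) _.
rewrite mulrA two -!rmorphM lecR.
by rewrite mulfVK.
Qed.

(** Expanding [f y] in the standard basis reduces this to products of scalar functions. *)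
Lemma differentiable_scale (K : numFieldType) (V : normedModType K) (n : nat)
    (k : V -> K) (f : V -> 'rV[K]_n) (x : V) :
  differentiable k x -> differentiable f x ->
  differentiable (fun y => k y *: f y) x.
Proof.
move=> dk df.
have -> : (fun y => k y *: f y) =
    \sum_(i < n) (fun y => (k y * f y 0 i) *: delta_mx 0 i : 'rV[K]_n).
  apply/funext => y; rewrite fct_sumE [in LHS](row_sum_delta (f y)) scaler_sumr.
  by apply: eq_bigr => i _; rewrite scalerA.
apply: differentiable_sum => i; apply: differentiableZl; apply: differentiableM => //.
exact: (differentiable_comp df (differentiable_coord _ 0 i)).
Qed.

(** Order 2 is the order of the bracket, a derivative of the differential [Ad]; second derivatives
    are reached through directional ones. *)
Lemma smooth_on_near (K : numFieldType) (V W : normedModType K) (U : set V)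
    (f : V -> W) (x : V) : nbhs x U -> smooth_on U f ->
  (\forall y \near x, differentiable f y) /\
  (forall v, \forall y \near x, differentiable ('D_v f) y).
Proof.
move=> xU /(_ 2%N) /= [fU DfU]; split; first exact: filterS xU.
by move=> v; have [dU _] := DfU v; apply: filterS xU.
Qed.

(** * The adjoint representation in the chart at 1 *)

Section LieChart.
Context (K : numFieldType) (n : nat) (G : lieGroup K n).
Local Notation V := 'rV[K]_n.
Local Notation c := (chart1 G).
Local Notation ci := (cinv (chart1 G)).
Local Notation e := (chart1 G 1%g).

Let chartP : is_chart c.
Proof. by have [+ _ _] := lie_atlasP G; apply. Qed.

Lemma chart1_dom1 : cdom c 1%g.
Proof. by have [_ + _] := lie_atlasP G; apply. Qed.

Lemma chart1K p : cdom c p -> ci (c p) = p.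
Proof. by have [_ _ + _ _] := chartP; apply. Qed.

Lemma chart1_nbhs1 : nbhs (1%g : G) (cdom c).
Proof.
have [oD _ _ _ _] := chartP; apply: open_nbhs_nbhs; split=> //.
exact: chart1_dom1.
Qed.

Lemma chart1_continuous p : cdom c p -> {for p, continuous c}.
Proof. by have [_ _ _ + _] := chartP; apply. Qed.

Lemma chart1_nbhs_img : \forall x \near e, (c @` cdom c) x.
Proof.
have [_ oc _ _ _] := chartP; apply: open_nbhs_nbhs; split=> //.
by exists 1%g => //; exact: chart1_dom1.
Qed.

Lemma cinv1_continuous x : (c @` cdom c) x -> {for x, continuous ci}.
Proof. by have [_ _ _ _ +] := chartP; apply. Qed.

Lemma cinv1_continuous1 : {for e, continuous ci}.
Proof. by apply: cinv1_continuous; exact: (nbhs_singleton chart1_nbhs_img). Qed.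

Lemma cinv1K x : (c @` cdom c) x -> c (ci x) = x.
Proof. by move=> [p Dp <-]; rewrite chart1K. Qed.

Lemma cinv1_dom x : (c @` cdom c) x -> cdom c (ci x).
Proof. by move=> [p Dp <-]; rewrite chart1K. Qed.

Lemma cinv1_1 : ci e = 1%g.
Proof. by rewrite chart1K //; exact: chart1_dom1. Qed.

Lemma near_cinv1 (P : set G) : nbhs (1%g : G) P -> \forall x \near e, P (ci x).
Proof.
have := cinv1_continuous1; rewrite /prop_for /continuous_at cinv1_1 => + P1.
by apply.
Qed.

(** The group law, and below it the inversion, read in the chart at 1. The formulas are meaningful
    only near [(e, e)] and near [e], where all elements involved lie in the chart domain. *)
Definition chart_mul (z : V * V) : V := c (ci z.1 * ci z.2)%g.
Definition chart_inv (x : V) : V := c (ci x)^-1%g.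

Lemma chart_inv1 : chart_inv e = e.
Proof. by rewrite /chart_inv cinv1_1 invg1. Qed.

Lemma chart_mul_near :
  \forall z \near (e, e), [/\ (c @` cdom c) z.1, (c @` cdom c) z.2 &
                              cdom c (ci z.1 * ci z.2)%g].
Proof.
have n1 : \forall z \near (e, e), (c @` cdom c) z.1.
  exact: (cvg_fst (F := nbhs e) (G := nbhs e) chart1_nbhs_img).
have n2 : \forall z \near (e, e), (c @` cdom c) z.2.
  exact: (cvg_snd (F := nbhs e) (G := nbhs e) chart1_nbhs_img).
have n3 : \forall z \near (e, e), cdom c (ci z.1 * ci z.2)%g.
  have [mulc _] := lie_mul_smooth G.
  have cc : {for (e, e), continuous (fun z : V * V => (ci z.1, ci z.2))}.
    by apply: cvg_pair; apply: continuous_comp;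
      [exact: cvg_fst | exact: cinv1_continuous1
      |exact: cvg_snd | exact: cinv1_continuous1].
  have := continuous_comp cc (mulc _).
  apply; rewrite /= cinv1_1 mulg1; exact: chart1_nbhs1.
by apply: filterS3 n1 n2 n3.
Qed.

Lemma chart_mul_smooth :
  (\forall z \near (e, e), differentiable chart_mul z) /\
  (forall v, \forall z \near (e, e), differentiable ('D_v chart_mul) z).
Proof.
have [_ /(_ (1%g, 1%g) 1%g)] := lie_mul_smooth G; apply: smooth_on_near.
apply: filterS chart_mul_near => -[x y] [/= cx cy Dxy].
exists (ci x, ci y); last by rewrite /= !cinv1K.
by split => //; split; exact: cinv1_dom.
Qed.

Lemma chart_inv_near :
  \forall x \near e, (c @` cdom c) x /\ cdom c (ci x)^-1%g.
Proof.
have n2 : \forall x \near e, cdom c (ci x)^-1%g.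
  have [invc _] := lie_inv_smooth G.
  have := continuous_comp cinv1_continuous1 (invc _).
  by apply; rewrite /= cinv1_1 invg1; exact: chart1_nbhs1.
by apply: filterS2 chart1_nbhs_img n2.
Qed.

Lemma chart_inv_differentiable : differentiable chart_inv e.
Proof.
have [_ /(_ 1%g 1%g) invs] := lie_inv_smooth G.
apply: (fun h => nbhs_singleton (proj1 (smooth_on_near (x := e) h invs))).
apply: filterS chart_inv_near => x [cx Dx].
by exists (ci x); [split=> //; exact: cinv1_dom | rewrite cinv1K].
Qed.

Lemma chart_mulx1 : \forall x \near e, chart_mul (x, e) = x.
Proof.
apply: filterS chart1_nbhs_img => x cx.
by rewrite /chart_mul /= cinv1_1 mulg1 cinv1K.
Qed.

Let left_cvg : {for e, continuous (fun x : V => (x, e))}.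
Proof. by apply: differentiable_continuous; exact: differentiable_pair. Qed.

Let pair_cvg : {for e, continuous (fun x : V => (x, chart_inv x))}.
Proof.
apply: differentiable_continuous; apply: differentiable_pair => //.
exact: chart_inv_differentiable.
Qed.

(** Properties near [(e, e)] are pulled back along x -> (x, e) and x -> (x, iota x), the two curves
    of base points at which mu is differentiated in [Ad]. *)
Let near_left (P : set (V * V)) : (\forall z \near (e, e), P z) ->
  \forall x \near e, P (x, e).
Proof. exact: left_cvg. Qed.

Let near_pair (P : set (V * V)) : (\forall z \near (e, e), P z) ->
  \forall x \near e, P (x, chart_inv x).
Proof.
have := pair_cvg; rewrite /prop_for /continuous_at chart_inv1 => + P1.
by apply.
Qed.

Let near_right x (P : set (V * V)) : (\forall z \near (x, e), P z) ->
  \forall y \near e, P (x, y).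
Proof.
have : {for e, continuous (fun y : V => (x, y))}.
  by apply: differentiable_continuous; exact: differentiable_pair.
exact.
Qed.

(** Conjugation becomes mu(mu(x, y), iota x) once all intermediate products stay in the chart
    domain. The neighbourhood of y may depend on x, which is enough to differentiate in y for each
    fixed x. *)
Lemma chart_conj_near : \forall x \near e, \forall y \near e,
  [/\ (c @` cdom c) y, cdom c (ci x * ci y * (ci x)^-1)%g &
      c (ci x * ci y * (ci x)^-1)%g = chart_mul (chart_mul (x, y), chart_inv x)].
Proof.
have [md _] := chart_mul_smooth.
near=> x.
(* [near_join] makes the good set a neighbourhood of every point close to [(e, e)], so it can be
   used around [(x, e)] with x fixed. *)
have good1 : \forall z \near (x, e), [/\ (c @` cdom c) z.1, (c @` cdom c) z.2 &
    cdom c (ci z.1 * ci z.2)%g].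
  by near: x; exact: near_left (near_join chart_mul_near).
have good2 : \forall z \near (x, chart_inv x), [/\ (c @` cdom c) z.1,
    (c @` cdom c) z.2 & cdom c (ci z.1 * ci z.2)%g].
  by near: x; exact: near_pair (near_join chart_mul_near).
have mx : chart_mul (x, e) = x by near: x; exact: chart_mulx1.
have [cx Dx] : (c @` cdom c) x /\ cdom c (ci x)^-1%g.
  by near: x; exact: chart_inv_near.
have mdx : differentiable chart_mul (x, e) by near: x; exact: near_left md.
have conj_cvg : {for e, continuous (fun y : V => (chart_mul (x, y), chart_inv x))}.
  apply: differentiable_continuous; apply: differentiable_pair => //.
  apply: (@differentiable_comp _ _ _ _ (fun y : V => (x, y)) chart_mul).
    exact: differentiable_pair.
  exact: mdx.
have good2' : \forall y \near e, cdom c (ci (chart_mul (x, y)) * ci (chart_inv x))%g.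
  have := conj_cvg [set z | cdom c (ci z.1 * ci z.2)%g]; apply.
  by rewrite /= mx; apply: filterS good2 => z [].
apply: filterS2 (near_right good1) good2' => y [/= _ cy Dxy] Dxyx.
have E1 : ci (chart_mul (x, y)) = (ci x * ci y)%g by rewrite chart1K.
have E2 : ci (chart_inv x) = (ci x)^-1%g by rewrite chart1K.
by rewrite E1 E2 in Dxyx; split=> //; rewrite {1}/chart_mul /= E1 E2.
Unshelve. all: by end_near. Qed.

Definition chart_conj (p : G) (y : V) : V := c (p * ci y * p^-1)%g.

(** Chain rule for y -> mu(mu(x, y), iota x) at y = e, where mu(x, e) = x; the second argument is
    constant in y, whence the 0. *)
Lemma chart_conj_diff : \forall x \near e, is_diff e (chart_conj (ci x))
  (fun Y => 'd chart_mul (x, chart_inv x) ('d chart_mul (x, e) (0, Y), 0)).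
Proof.
have [md _] := chart_mul_smooth.
near=> x.
have mdx : differentiable chart_mul (x, e) by near: x; exact: near_left md.
have mdx' : differentiable chart_mul (x, chart_inv x) by near: x; exact: near_pair md.
have mx : chart_mul (x, e) = x by near: x; exact: chart_mulx1.
have d1 : is_diff e (fun y : V => (x, y)) (fun Y => (0, Y)).
  exact: is_diff_pair.
have d2 : is_diff e (fun y : V => (chart_mul (x, y), chart_inv x))
    (fun Y => ('d chart_mul (x, e) (0, Y), 0)).
  apply: is_diff_pair (is_diff_cst (chart_inv x) e).
  exact: (is_diff_comp (g := chart_mul) d1 (differentiableP mdx)).
have mdx2 : differentiable chart_mul (chart_mul (x, e), chart_inv x) by rewrite mx.
have d3 : is_diff e (fun y => chart_mul (chart_mul (x, y), chart_inv x))
  (fun Y => 'd chart_mul (x, chart_inv x) ('d chart_mul (x, e) (0, Y), 0)).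
  apply: (is_diff_comp (g := chart_mul) d2 _).
  by have := differentiableP mdx2; rewrite [in 'd _ _]mx.
have E : \forall y \near e,
    chart_mul (chart_mul (x, y), chart_inv x) = chart_conj (ci x) y.
  have : \forall y \near e,
  [/\ (c @` cdom c) y, cdom c (ci x * ci y * (ci x)^-1)%g &
      c (ci x * ci y * (ci x)^-1)%g = chart_mul (chart_mul (x, y), chart_inv x)].
    by near: x; exact: chart_conj_near.
  by apply: filterS => y [_ _ <-].
have := near_eq_is_diff E (@ex_diff _ _ _ _ _ _ _ d3).
by rewrite (@diff_val _ _ _ _ _ _ _ d3).
Unshelve. all: by end_near. Qed.

(** In the formula for Ad both the base point and the vector vary with x. Expanding the inner vector
    W in the standard basis leaves a sum of scalar functions times directional derivatives of mu in
    fixed directions, each differentiable since mu is twice differentiable. *)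
Lemma Ad_differentiable (Y : V) : differentiable (fun x => Ad (ci x) Y) e.
Proof.
have [md Dmd] := chart_mul_smooth.
pose W x := 'D_(0, Y) chart_mul (x, e).
pose E (j : 'I_n) x := 'D_(delta_mx 0 j, 0) chart_mul (x, chart_inv x).
have d_inv := chart_inv_differentiable.
have dE j : differentiable (E j) e.
  apply: (differentiable_comp (f := fun x : V => (x, chart_inv x))
    (g := 'D_(delta_mx 0 j, 0) chart_mul)).
    exact: differentiable_pair.
  by rewrite chart_inv1; exact: nbhs_singleton (Dmd _).
have dW : differentiable W e.
  apply: (differentiable_comp (f := fun x : V => (x, e)) (g := 'D_(0, Y) chart_mul)).
    exact: differentiable_pair.
  exact: nbhs_singleton (Dmd _).
apply: (@near_eq_differentiable _ _ _ (\sum_j (fun x => W x 0 j *: E j x))); last first.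
  apply: differentiable_sum => j; apply: differentiable_scale => //.
  exact: (differentiable_comp dW (differentiable_coord _ 0 j)).
near=> x.
have mdx : differentiable chart_mul (x, e) by near: x; exact: near_left md.
have mdx' : differentiable chart_mul (x, chart_inv x) by near: x; exact: near_pair md.
have cx : is_diff e (chart_conj (ci x))
  (fun Y => 'd chart_mul (x, chart_inv x) ('d chart_mul (x, e) (0, Y), 0)).
  by near: x; exact: chart_conj_diff.
have WE : W x = 'd chart_mul (x, e) (0, Y) by rewrite /W deriveE.
have -> : Ad (ci x) Y = 'd chart_mul (x, chart_inv x) (W x, 0).
  by rewrite WE; exact: (congr1 (fun f : V -> V => f Y) (@diff_val _ _ _ _ _ _ _ cx)).
rewrite fct_sumE.
have -> : (W x, 0) = \sum_j W x 0 j *: (delta_mx 0 j, 0) :> V * V.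
  rewrite {1}(row_sum_delta (W x)).
  elim/big_rec2: _ => [//|j u w _ <-].
  by congr (_, _); rewrite /= scaler0 addr0.
rewrite linear_sum; apply: eq_bigr => j _.
by rewrite linearZ /E deriveE.
Unshelve. all: by end_near. Qed.

Lemma bracket_linearl (Y : V) : linear (fun X : V => bracket G X Y).
Proof. by move=> a X1 X2; rewrite /bracket linearP. Qed.

(** Here a linear combination of the maps x -> Ad Y is differentiated, which rests on their
    differentiability at [e]; linearity in the other argument is that of a differential. *)
Lemma bracket_linearr (X : V) : linear (bracket G X).
Proof.
move=> a Y1 Y2; rewrite /bracket.
have -> : (fun p : G => Ad p (a *: Y1 + Y2)) \o ci =
    (fun x => a *: Ad (ci x) Y1 + Ad (ci x) Y2).
  by apply/funext => x /=; rewrite /Ad /tangent_map linearP.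
exact: (diff_linear_combination a X (Ad_differentiable Y1) (Ad_differentiable Y2)).
Qed.

Lemma near_chart_conj_differentiable :
  \forall x \near e, differentiable (chart_conj (ci x)) e.
Proof. by apply: filterS chart_conj_diff => x []. Qed.

End LieChart.

(** * Lie group homomorphisms into a complex Lie group *)

Section LieHom.
Context (R : realType) (n m : nat) (G : lieGroup R n) (H : lieGroup R[i] m).
Variable F : G -> H.
Hypothesis FM : {morph F : x y / (x * y)%g}.
Hypothesis F_smooth : smooth_map (@lie_atlas _ _ G)
  (fun p => real_chart (@lie_atlas _ _ H p)) F.
Local Notation ci := (cinv (chart1 G)).
Local Notation di := (cinv (chart1 H)).
Local Notation e := (chart1 G 1%g).
Local Notation eH := (chart1 H 1%g).

Lemma lie_hom1 : F 1%g = 1%g.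
Proof. by apply: (mulgI (F 1%g)); rewrite -FM !mulg1. Qed.

Lemma lie_homV x : F x^-1%g = (F x)^-1%g.
Proof. by apply: (mulgI (F x)); rewrite -FM !mulgV lie_hom1. Qed.

(** [F] read in the charts at 1, with real coordinates on the target; [lie_diff F] is [complexify]
    after the differential of [f] at [e]. *)
Let f : 'rV[R]_n -> 'rV[R]_(m + m) := real_chart (chart1 H) \o F \o ci.

Let fK x : complexify (f x) = chart1 H (F (ci x)).
Proof. exact: realifyK. Qed.

Let fe : complexify (f e) = eH.
Proof. by rewrite fK cinv1_1 lie_hom1. Qed.

Let F_near : nbhs (1%g : G) (F @^-1` cdom (chart1 H)).
Proof.
have [Fc _] := F_smooth; apply: Fc; rewrite lie_hom1; exact: chart1_nbhs1.
Qed.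

Let f_diff : differentiable f e.
Proof.
have [_ /(_ 1%g 1%g) Fs] := F_smooth.
apply: (fun h => nbhs_singleton (proj1 (smooth_on_near (x := e) h Fs))).
apply: filterS2 (chart1_nbhs_img G) (near_cinv1 F_near) => x cx Fx.
by exists (ci x); [split=> //; exact: cinv1_dom | exact: cinv1K].
Qed.

Let near_F (P : set 'rV[R[i] : numFieldType]_m) : (\forall z \near eH, P z) ->
  \forall x \near e, P (chart1 H (F (ci x))).
Proof.
move=> Pz; apply: (near_cinv1 (P := fun p => P (chart1 H (F p)))).
have [Fc _] := F_smooth.
have := continuous_comp (Fc 1%g) (_ : {for F 1%g, continuous (chart1 H)}).
rewrite lie_hom1 => /(_ (chart1_continuous (chart1_dom1 H))).
by apply; rewrite /= lie_hom1.
Qed.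

Lemma lie_diff_linear a X Y :
  lie_diff F (a *: X + Y) = a%:C%C *: lie_diff F X + lie_diff F Y.
Proof. by rewrite /lie_diff /tangent_map linearP complexify_linear. Qed.

(** Differentiates F(p q p^-1) = F(p) F(q) F(p)^-1 in q at 1. On the target side the real derivative
    of the conjugation is the realified complex one. *)
Lemma lie_diff_Ad : \forall x \near e, forall Y,
  'd f e (Ad (ci x) Y) = realify (Ad (F (ci x)) (lie_diff F Y)).
Proof.
near=> x => Y.
have Fp : cdom (chart1 H) (F (ci x)) by near: x; exact: near_cinv1 F_near.
have dp : is_diff e (chart_conj (ci x))
  (fun Y => 'd (chart_mul G) (x, chart_inv G x) ('d (chart_mul G) (x, e) (0, Y), 0)).
  by near: x; exact: chart_conj_diff.
have dp' : differentiable (chart_conj (ci x)) e by exact: ex_diff.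
(* Differentiability of conjugation in the target is known for elements given by coordinates near
   [eH]; [near_F] brings it to the coordinates of [F (ci x)], and [chart1K] returns to the element
   itself. *)
have dq : differentiable (chart_conj (F (ci x))) eH.
  have : differentiable (chart_conj (di (chart1 H (F (ci x))))) eH.
    near: x; exact: near_F (near_chart_conj_differentiable H).
  by rewrite chart1K.
have conj_e : chart_conj (ci x) e = e by rewrite /chart_conj cinv1_1 mulg1 mulgV.
have E : \forall y \near e, f (chart_conj (ci x) y) =
    realify (chart_conj (F (ci x)) (complexify (f y))).
  have cn : \forall y \near e, [/\ (chart1 G @` cdom (chart1 G)) y,
      cdom (chart1 G) (ci x * ci y * (ci x)^-1)%g &
      chart1 G (ci x * ci y * (ci x)^-1)%g =
      chart_mul G (chart_mul G (x, y), chart_inv G x)].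
    by near: x; exact: chart_conj_near.
  apply: filterS2 cn (near_cinv1 F_near) => y [_ Dxy _] Fy.
  by rewrite fK /chart_conj chart1K // /f /= chart1K // !FM lie_homV.
have dl : is_diff e (f \o chart_conj (ci x)) ('d f e \o 'd (chart_conj (ci x)) e).
  apply: is_diff_comp; first exact: differentiableP.
  by rewrite conj_e; exact: differentiableP.
have dr : is_diff e ((@realify R m \o chart_conj (F (ci x)) \o @complexify R m) \o f)
    ((@realify R m \o 'd (chart_conj (F (ci x))) eH \o @complexify R m) \o 'd f e).
  apply: is_diff_comp; first exact: differentiableP.
  by rewrite -fe; apply: realify_is_diff; rewrite fe.
exact: (congr1 (fun h => h Y) (near_eq_is_diff_unique E dl dr)).
Unshelve. all: by end_near. Qed.

(** Differentiates dF(Ad(p) Y) = Ad(F(p)) (dF Y) in p at 1: on the left dF is a fixed linear map, on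
    the right the chain rule applies to the complex map [a] composed with [f]. *)
Lemma lie_diff_bracket X Y :
  lie_diff F (bracket G X Y) = bracket H (lie_diff F X) (lie_diff F Y).
Proof.
pose a z := Ad (di z) (lie_diff F Y).
have da : differentiable a eH by exact: Ad_differentiable.
have dl : is_diff e ('d f e \o (fun x => Ad (ci x) Y))
    ('d f e \o 'd (fun x => Ad (ci x) Y) e).
  apply: is_diff_comp; first exact/differentiableP/Ad_differentiable.
  exact: linear_is_diff (diff_continuous f_diff).
have dr : is_diff e ((@realify R m \o a \o @complexify R m) \o f)
    ((@realify R m \o 'd a eH \o @complexify R m) \o 'd f e).
  apply: is_diff_comp; first exact: differentiableP.
  by rewrite -fe; apply: realify_is_diff; rewrite fe.
have E : \forall x \near e, ('d f e \o (fun x => Ad (ci x) Y)) x =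
    ((@realify R m \o a \o @complexify R m) \o f) x.
  apply: filterS2 lie_diff_Ad (near_cinv1 F_near) => x xY Fx.
  by rewrite /= xY /a fK chart1K.
apply: (etrans (congr1 (fun h => complexify (h X)) (near_eq_is_diff_unique E dl dr))).
exact: realifyK.
Qed.
End LieHom.

(** * Wick rotations *)

Lemma symmetric_form_scalar (K : fieldType) (n : nat)
    (g : {symmetric 'rV[K]_n}) X : scalar (g X).
Proof. by move=> a Y Z; rewrite linearPr. Qed.

Lemma symmetric_formC (K : fieldType) (n : nat)
    (g : {symmetric 'rV[K]_n}) X Y : g X Y = g Y X.
Proof. by rewrite hermC expr0 mul1r. Qed.

Lemma wick_rotated_sym (R : realType) (n n' : nat)
    (G : pseudoRiemannianLieGroup R n) (G' : pseudoRiemannianLieGroup R n') :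
  wick_rotated G G' -> wick_rotated G' G.
Proof. by move=> [m [GC [F [F' [? ?]]]]]; exists m, GC, F', F. Qed.

(** The two slices exhibit both Lie algebras as real forms of that of [GC], compatibly with bracket
    and metric, as [cartan_transfer] requires. *)
Lemma wick_rotated_cartan (R : realType) (n n' : nat)
    (G : pseudoRiemannianLieGroup R n) (G' : pseudoRiemannianLieGroup R n') :
  wick_rotated G G' ->
  (exists theta, @cartan_involution R n G theta) ->
  (exists theta', @cartan_involution R n' G' theta').
Proof.
move=> [m [GC [F [F' [[[FM [Fs _] Fb] Fg] [[FM' [Fs' _] Fb'] Fg']]]]]].
move=> [theta [tB tK tg tp]].
have [theta' [tB' tK' tg' tp']] := cartan_transfer
  (@bracket_linearr _ _ GC) (@bracket_linearl _ _ GC)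
  (symmetric_form_scalar (metric GC)) (symmetric_formC (metric GC))
  (@lie_diff_linear _ _ _ G GC F) Fb
  (fun X Y => esym (lie_diff_bracket FM Fs X Y)) Fg
  (@lie_diff_linear _ _ _ G' GC F') Fb'
  (fun X Y => esym (lie_diff_bracket FM' Fs' X Y)) Fg' tB tK tg tp.
by exists theta'; split.
Qed.

Theorem theorem1 (R : realType) (n n' : nat)
    (G : pseudoRiemannianLieGroup R n) (G' : pseudoRiemannianLieGroup R n')
    (hW : wick_rotated G G') :
  (exists theta, @cartan_involution R n G theta) <->
  (exists theta', @cartan_involution R n' G' theta').
Proof.
by split; apply: wick_rotated_cartan => //; exact: wick_rotated_sym.
Qed.
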